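(* Define the quadratic function $$\mathfrak{W}(U_2,U_3):=\tfrac12(D_{2,1}U_2^2+D_{3,1}U_3^2)$$ and suppose $$3\Omega^2\ge2D_{2,1}/D_{3,1},\qquad 16\sqrt{D_{2,1}/D_{3,1}}\le\gamma.$$ Then for all $\alpha>0$, and all $\mathcal{E}:=1+\delta_a$ with $|\delta_a|\le(\gamma/4)^2$, all the solutions of the system for $U$ starting in the set $$\mathcal{B}_{\mathcal{E}}:=\left\{U\in\mathbb{R}^3:\ |U_1|\le\gamma/4,\ \ \mathfrak{W}(U_2,U_3)\le\frac{(D_{2,1}\gamma)^2}{32D_{3,1}\Omega^2}\right\}\cap\{\tilde\Psi(U)=\mathcal{E}\}$$ satisfy $$U_\infty(\delta_a):=\lim_{t\to+\infty}\Phi_a^t(\mathcal{B}_{\mathcal{E}})=\bigl(-\gamma+\sqrt{\gamma^2+\delta_a},\,0,\,0\bigr)$$ and $$|U_\infty(\delta_a)|\le\delta_a/(2\gamma).$$ In particular, those trajectories with $\mathcal{E}=1$ are asymptotic to $U=0$ (and hence $u(t)\to s^+$). Furthermore, the projection of $\mathcal{B}_{\mathcal{E}}$ on the plane $(U_2,U_3)$ contains the disk centred at the origin of radius $$r_{sm}:=(4|\Omega|D_{3,1})^{-1}\gamma D_{2,1}.$$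
   Context: Let $0<D_1<D_2<D_3$, $D_{i,j}:=D_i-D_j$, $\Omega>0$, $\gamma:=\sqrt{1-\Omega^2}$ and $h_2:=-D_{2,1}\Omega$. Consider the (zero current) system for $u=(u_1,u_2,u_3)\in\mathbb{R}^3$ $$\begin{cases} \dot u_1=h_2u_3+D_{3,2}u_2u_3+\alpha u_1(D_{3,1}u_3^2+D_{2,1}u_2^2-h_2u_2)\\ \dot u_2=-D_{3,1}u_1u_3+\alpha(D_{3,2}u_2u_3^2-D_{2,1}u_2u_1^2+h_2u_1^2+h_2u_3^2)\\ \dot u_3=-h_2u_1+D_{2,1}u_1u_2-\alpha u_3(D_{3,2}u_2^2+D_{3,1}u_1^2+h_2u_2), \end{cases}$$ for which $\Psi(u)=u_1^2+u_2^2+u_3^2$ is conserved and $s^+:=(\gamma,-\Omega,0)$ is an equilibrium. Put $u=U+s^+$; ''the system for $U$'' is the system above written in the variables $U=(U_1,U_2,U_3)$, $\Phi_a^t$ is its flow, and $\tilde\Psi(U):=\Psi(U+s^+)=(U_1+\gamma)^2+(U_2-\Omega)^2+U_3^2$. The limit of $\Phi_a^t(\mathcal{B}_{\mathcal{E}})$ refers to the common limit of all solutions starting in $\mathcal{B}_{\mathcal{E}}$. $|\cdot|$ is the Euclidean norm.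
   Formalization: The bound |U_∞(δ_a)| ≤ δ_a/(2γ) is false for every δ_a < 0 (its right side is negative); it is proved as printed for δ_a ≥ 0, and for δ_a < 0 it is replaced by |U_∞(δ_a)| ≤ |δ_a|/(2√(γ²+δ_a)). *)

(* Defs.v *)
From Stdlib Require Import Reals.
From Coquelicot Require Import Coquelicot.
Open Scope R_scope.

(* R^3 is [R * R * R] with Coquelicot's product structure; its uniform structure
   is the usual topology, so derivatives and limits are componentwise. *)
Definition R3 : Type := (R * R * R)%type.

Definition norm3 (u : R3) : R :=
  let '(u1, u2, u3) := u in sqrt (u1 ^ 2 + u2 ^ 2 + u3 ^ 2).

Definition h2 (D1 D2 Omega : R) : R := - (D2 - D1) * Omega.

(* [sqrt] is 0 on negative numbers: this is meaningful for Omega <= 1 only. *)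
Definition gam (Omega : R) : R := sqrt (1 - Omega ^ 2).

Definition s_plus (Omega : R) : R3 := (gam Omega, - Omega, 0).

Definition field (D1 D2 D3 Omega alpha : R) (u : R3) : R3 :=
  let '(u1, u2, u3) := u in
  let D21 := D2 - D1 in
  let D31 := D3 - D1 in
  let D32 := D3 - D2 in
  let h := h2 D1 D2 Omega in
  ( h * u3 + D32 * u2 * u3
      + alpha * u1 * (D31 * u3 ^ 2 + D21 * u2 ^ 2 - h * u2),
    - D31 * u1 * u3
      + alpha * (D32 * u2 * u3 ^ 2 - D21 * u2 * u1 ^ 2
                 + h * u1 ^ 2 + h * u3 ^ 2),
    - h * u1 + D21 * u1 * u2
      - alpha * u3 * (D32 * u2 ^ 2 + D31 * u1 ^ 2 + h * u2) ).

Definition fieldU (D1 D2 D3 Omega alpha : R) (U : R3) : R3 :=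
  field D1 D2 D3 Omega alpha (plus U (s_plus Omega)).

(* Forward solutions on [0, +oo).  Values at negative times are irrelevant: only
   right continuity is required at 0 (for continuous F this is equivalent to
   requiring the right derivative at 0 as well). *)
Definition solution (F : R3 -> R3) (u : R -> R3) : Prop :=
  filterlim u (at_right 0) (locally (u 0)) /\
  forall t : R, 0 < t -> is_derive u t (F (u t)).

Definition Psi (u : R3) : R :=
  let '(u1, u2, u3) := u in u1 ^ 2 + u2 ^ 2 + u3 ^ 2.

Definition PsiU (Omega : R) (U : R3) : R := Psi (plus U (s_plus Omega)).

Definition W (D1 D2 D3 U2 U3 : R) : R :=
  / 2 * ((D2 - D1) * U2 ^ 2 + (D3 - D1) * U3 ^ 2).

Definition B (D1 D2 D3 Omega E : R) (U : R3) : Prop :=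
  let '(U1, U2, U3) := U in
  Rabs U1 <= gam Omega / 4 /\
  W D1 D2 D3 U2 U3
    <= ((D2 - D1) * gam Omega) ^ 2 / (32 * (D3 - D1) * Omega ^ 2) /\
  PsiU Omega U = E.

Definition U_inf (Omega delta : R) : R3 :=
  (- gam Omega + sqrt (gam Omega ^ 2 + delta), 0, 0).

Definition r_sm (D1 D2 D3 Omega : R) : R :=
  / (4 * Rabs Omega * (D3 - D1)) * gam Omega * (D2 - D1).

(* Main.v *)
Require Import Defs.
From Stdlib Require Import Reals Lra Lia IndefiniteDescription.
From Coquelicot Require Import Coquelicot.
Open Scope R_scope.

(** Write p = D2 - D1, q = D3 - D1, V2 = u2 + Omega, and consider W as a function
    of (V2, u3).  Along the flow the non-dissipative terms of W' cancel, and what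
    remains is minus alpha times a sum of squares
    ([W_dissipation]):

      W' = - alpha (p^2 u1^2 V2^2 + u3^2 ((q - p) V2 - q Omega)^2 + q^2 u1^2 u3^2)
         <= - 2 alpha p u1^2 W.

    So W never increases, wherever the trajectory is.  Since Psi is conserved,
    u1^2 = gamma^2 + delta + 2 Omega V2 - V2^2 - u3^2, and the two hypotheses on
    the parameters make the last three terms small on the sublevel set of W that
    defines B, as delta is by assumption: there u1^2 lies between (3 gamma / 4)^2 and (5 gamma / 4)^2
    ([energy_sublevel_bounds]).  Hence u1^2 is bounded away from 0 for all times,
    W decays exponentially, V2 and u3 tend to 0, and u1, which cannot change sign,
    tends to sqrt (gamma^2 + delta) ([field_converges]).  The same two-sided
    bound on u1^2 shows that every (U2, U3) of the sublevel set lies below a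
    point of B, and the disk of radius r_sm is contained in that sublevel set
    ([disk_in_projection]).

    Solutions exist for all times because Psi is conserved, but the field is only
    locally Lipschitz.  It is therefore evaluated at the point u pulled back
    radially into a large ball: the new field is globally Lipschitz, so Picard
    iteration gives a global solution ([lipschitz_global_solution]), and it is
    still orthogonal to u because the clipped point is a multiple of u.  Its
    solution thus stays on a sphere where clipping does nothing, and solves the
    original system ([field_global_solution]). *)

(** * Products of complete normed modules *)
Lemma prod_cauchy_lim (U V : CompleteSpace) (G : (U * V -> Prop) -> Prop) :
  ProperFilter G -> cauchy G ->
  forall eps : posreal,
    G (ball (lim (filtermap fst G), lim (filtermap snd G)) eps).
Proof.
intros PG CG eps.
assert (H1 : G (fun x => ball (lim (filtermap fst G)) eps (fst x))).
{ apply (complete_cauchy (filtermap fst G)).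
  - now apply filtermap_proper_filter.
  - intros e; destruct (CG e) as [x Hx]; exists (fst x).
    unfold filtermap.
    apply (filter_imp (F := G)) with (P := ball x e); [intros y [Hy _]; exact Hy | exact Hx]. }
assert (H2 : G (fun x => ball (lim (filtermap snd G)) eps (snd x))).
{ apply (complete_cauchy (filtermap snd G)).
  - now apply filtermap_proper_filter.
  - intros e; destruct (CG e) as [x Hx]; exists (snd x).
    unfold filtermap.
    apply (filter_imp (F := G)) with (P := ball x e); [intros y [_ Hy]; exact Hy | exact Hx]. }
generalize (filter_and _ _ H1 H2); apply filter_imp; intros y [A C]; now split.
Qed.

Lemma prod_lim_ext (U V : CompleteSpace) (G1 G2 : (U * V -> Prop) -> Prop) :
  filter_le G1 G2 -> filter_le G2 G1 ->
  close (lim (filtermap fst G1), lim (filtermap snd G1))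
        (lim (filtermap fst G2), lim (filtermap snd G2)).
Proof.
intros H12 H21 eps; split.
- apply (close_lim (filtermap fst G1) (filtermap fst G2)); intros P HP;
    [apply H12 | apply H21]; exact HP.
- apply (close_lim (filtermap snd G1) (filtermap snd G2)); intros P HP;
    [apply H12 | apply H21]; exact HP.
Qed.

Definition prod_CompleteSpace_mixin (U V : CompleteSpace) :=
  CompleteSpace.Mixin (prod_UniformSpace U V) _
    (prod_cauchy_lim U V) (prod_lim_ext U V).

(** Declared canonical so that integrals and limits of curves in [R3] are
    available, a product of normed modules being complete componentwise. *)
Canonical prod_CompleteNormedModule (K : AbsRing) (U V : CompleteNormedModule K) :=
  CompleteNormedModule.Pack K (U * V)
    (CompleteNormedModule.Class K (U * V)
       (NormedModule.class K (prod_NormedModule K U V))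
       (prod_CompleteSpace_mixin U V)) (U * V).

(** * Distances in normed modules *)

Lemma plus_minus_l (G : AbelianGroup) (a b : G) : minus (plus a b) a = b.
Proof.
change (plus (plus a b) (opp a) = b).
rewrite (plus_comm a b), <- plus_assoc, plus_opp_r; apply plus_zero_r.
Qed.

Lemma minus_plus_l (G : AbelianGroup) (a b c : G) :
  minus (plus a b) (plus a c) = minus b c.
Proof.
rewrite (minus_trans a (plus a b)), plus_minus_l, <- (opp_minus (plus a c)).
now rewrite plus_minus_l.
Qed.

Lemma plus_opp_cancel (G : AbelianGroup) (a b : G) : plus (plus a (opp b)) b = a.
Proof.
transitivity (plus a (plus (opp b) b)); [symmetry; apply plus_assoc|].
transitivity (plus a zero); [f_equal; apply plus_opp_l | apply plus_zero_r].
Qed.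

Lemma minus_plus_r (G : AbelianGroup) (a b : G) : minus (plus a b) b = a.
Proof.
transitivity (plus a (plus b (opp b))); [symmetry; apply plus_assoc|].
transitivity (plus a zero); [f_equal; apply plus_opp_r | apply plus_zero_r].
Qed.

(** A single constant for the distance keeps the algebraic structure on which
    [minus] lives out of sight: two terms that differ only in that structure would
    not be identified by linear arithmetic. *)
Definition ndist {V : NormedModule R_AbsRing} (x y : V) : R := norm (minus x y).

Lemma ndist_sym (V : NormedModule R_AbsRing) (x y : V) :
  ndist x y = ndist y x.
Proof. unfold ndist; now rewrite <- norm_opp, opp_minus. Qed.

Lemma ndist_diag (V : NormedModule R_AbsRing) (x : V) : ndist x x = 0.
Proof. unfold ndist; rewrite minus_eq_zero; exact norm_zero. Qed.

Lemma ndist_triangle (V : NormedModule R_AbsRing) (x y z : V) :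
  ndist x z <= ndist x y + ndist y z.
Proof. unfold ndist; rewrite (minus_trans y x z); apply norm_triangle. Qed.

Lemma ndist_plus_l (V : NormedModule R_AbsRing) (a b c : V) :
  ndist (plus a b) (plus a c) = ndist b c.
Proof. exact (f_equal norm (minus_plus_l V a b c)). Qed.

Lemma ndist_plus_self (V : NormedModule R_AbsRing) (a b : V) :
  ndist (plus a b) a = norm b.
Proof. exact (f_equal norm (plus_minus_l V a b)). Qed.

Lemma filterlim_ndist {T : Type} {V : NormedModule R_AbsRing}
    {G : (T -> Prop) -> Prop} {FG : Filter G} (f : T -> V) (l : V) :
  filterlim f G (locally l) <->
  forall eps : posreal, G (fun x => ndist (f x) l < eps).
Proof. exact (filterlim_locally_ball_norm f l). Qed.

(** * Global solutions for Lipschitz fields *)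

Lemma lipschitz_continuous (V : NormedModule R_AbsRing) (F : V -> V) (L : R) :
  0 < L ->
  (forall x y, ndist (F x) (F y) <= L * ndist x y) ->
  forall x, continuous F x.
Proof.
intros HL lip x; apply filterlim_ndist; intros eps.
assert (He : 0 < eps / L) by (apply Rdiv_lt_0_compat; [apply cond_pos | exact HL]).
apply locally_le_locally_norm; exists (mkposreal _ He); intros y Hy.
apply Rle_lt_trans with (1 := lip y x).
apply Rmult_lt_reg_l with (/ L); [now apply Rinv_0_lt_compat|].
rewrite <- Rmult_assoc, Rinv_l, Rmult_1_l by lra.
rewrite Rmult_comm; exact Hy.
Qed.

Lemma continuous_Rmax_0 (t : R) : continuous (Rmax 0) t.
Proof.
apply filterlim_locally; intros eps; exists eps; intros y Hy.
change (Rabs (y - t) < eps) in Hy; change (Rabs (Rmax 0 y - Rmax 0 t) < eps).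
revert Hy; unfold Rmax; destruct (Rle_dec 0 y), (Rle_dec 0 t);
  unfold Rabs; repeat destruct Rcase_abs; lra.
Qed.

Lemma is_derive_primitive (V : CompleteNormedModule R_AbsRing) (g : R -> V)
    (t : R) :
  (forall s, continuous g s) -> is_derive (fun t => RInt g 0 t) t (g t).
Proof.
intros Hg; apply (is_derive_RInt g _ 0); [|apply Hg].
apply filter_forall; intros b; apply RInt_correct, ex_RInt_continuous.
intros; apply Hg.
Qed.

Lemma exp_le_compat (x y : R) : x <= y -> exp x <= exp y.
Proof. intros [H|H]; [now apply Rlt_le, exp_increasing | subst; lra]. Qed.

(** The weight exp (2 L t) is chosen so that integrating L times the weight gives
    back at most half of it: this makes the integral operator a contraction with
    ratio 1/2 on the whole half-line. *)
Lemma norm_primitive_le_exp (V : CompleteNormedModule R_AbsRing) (g : R -> V)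
    (L C t : R) :
  (forall s, continuous g s) -> 0 < L -> 0 <= t -> 0 <= C ->
  (forall s, 0 <= s <= t -> norm (g s) <= L * (C * exp (2 * L * s))) ->
  norm (RInt g 0 t) <= C / 2 * exp (2 * L * t).
Proof.
intros Hg HL Ht HC Hb.
apply Rle_trans with (C / 2 * exp (2 * L * t) - C / 2 * exp (2 * L * 0)).
- refine (norm_RInt_le g (fun s => L * (C * exp (2 * L * s))) 0 t _ _ Ht Hb _ _).
  + apply RInt_correct, ex_RInt_continuous; intros; apply Hg.
  + refine (is_RInt_derive (fun s => C / 2 * exp (2 * L * s))
      (fun s => L * (C * exp (2 * L * s))) 0 t _ _).
    * intros s _; auto_derive; [easy | field].
    * intros s _; apply (ex_derive_continuous (fun s => L * (C * exp (2 * L * s)))).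
      auto_derive; easy.
- rewrite Rmult_0_r, exp_0; lra.
Qed.

(** Time is cut off at 0 in the integral, which makes every iterate a continuous
    function on the whole line, constant for negative times. *)
Fixpoint picard {V : CompleteNormedModule R_AbsRing} (F : V -> V) (x0 : V)
    (n : nat) (t : R) : V :=
  match n with
  | O => x0
  | S n => plus x0 (RInt (fun s => F (picard F x0 n s)) 0 (Rmax 0 t))
  end.

Lemma continuous_picard (V : CompleteNormedModule R_AbsRing) (F : V -> V)
    (x0 : V) (n : nat) :
  (forall x, continuous F x) -> forall t, continuous (picard F x0 n) t.
Proof.
intros HF; induction n as [|n IH]; intros t; simpl.
- apply continuous_const.
- apply (continuous_plus (fun _ => x0)); [apply continuous_const|].
  apply (continuous_comp (Rmax 0)
           (fun r => RInt (fun s => F (picard F x0 n s)) 0 r)).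
  + apply continuous_Rmax_0.
  + apply (ex_derive_continuous (K := R_AbsRing) (V := V)); eexists; apply is_derive_primitive.
    intros s; apply continuous_comp; [apply IH | apply HF].
Qed.

Lemma integral_operator_contracts (V : CompleteNormedModule R_AbsRing)
    (F : V -> V) (L C : R) (x0 : V) (x y : R -> V) :
  0 < L -> 0 <= C ->
  (forall a b, ndist (F a) (F b) <= L * ndist a b) ->
  (forall t, continuous x t) -> (forall t, continuous y t) ->
  (forall t, ndist (x t) (y t) <= C * exp (2 * L * Rmax 0 t)) ->
  forall t,
    ndist (plus x0 (RInt (fun s => F (x s)) 0 (Rmax 0 t)))
                (plus x0 (RInt (fun s => F (y s)) 0 (Rmax 0 t)))
      <= C / 2 * exp (2 * L * Rmax 0 t).
Proof.
intros HL HC lip Hx Hy Hxy t.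
assert (HF := lipschitz_continuous V F L HL lip).
assert (HFx : forall s, continuous (fun s => F (x s)) s)
  by (intros s; apply continuous_comp; auto).
assert (HFy : forall s, continuous (fun s => F (y s)) s)
  by (intros s; apply continuous_comp; auto).
eapply Rle_trans; [apply Req_le, (ndist_plus_l V)|]; unfold ndist.
rewrite <- (RInt_minus (V := V)) by (apply ex_RInt_continuous; auto).
apply norm_primitive_le_exp; auto using Rmax_l.
- intros s; apply (continuous_minus (V := V)); auto.
- intros s [Hs _]; apply Rle_trans with (1 := lip _ _).
  apply Rmult_le_compat_l; [lra|].
  generalize (Hxy s); now rewrite (Rmax_right 0 s Hs).
Qed.

Lemma picard_step (V : CompleteNormedModule R_AbsRing) (F : V -> V) (L : R)
    (x0 : V) :
  0 < L ->
  (forall a b, ndist (F a) (F b) <= L * ndist a b) ->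
  forall n t,
    ndist (picard F x0 (S n) t) (picard F x0 n t)
      <= norm (F x0) / (2 * L) * (1 / 2) ^ n * exp (2 * L * Rmax 0 t).
Proof.
intros HL lip.
assert (HF := lipschitz_continuous V F L HL lip).
assert (HK : 0 <= norm (F x0) / (2 * L))
  by (apply Rdiv_le_0_compat; [apply norm_ge_0 | lra]).
induction n as [|n IH]; intros t.
- simpl picard; rewrite pow_O, Rmult_1_r.
  eapply Rle_trans; [apply Req_le, (ndist_plus_self V)|].
  replace (norm (F x0) / (2 * L)) with (norm (F x0) / L / 2) by (field; lra).
  apply norm_primitive_le_exp; auto using Rmax_l.
  + intros s; apply continuous_const.
  + apply Rdiv_le_0_compat; [apply norm_ge_0 | lra].
  + intros s [Hs _].
    replace (L * (norm (F x0) / L * exp (2 * L * s)))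
      with (norm (F x0) * exp (2 * L * s)) by (field; lra).
    rewrite <- (Rmult_1_r (norm (F x0))) at 1.
    apply Rmult_le_compat_l; [apply norm_ge_0|].
    rewrite <- exp_0; apply exp_le_compat; apply Rmult_le_pos; lra.
- replace (norm (F x0) / (2 * L) * (1 / 2) ^ S n)
    with (norm (F x0) / (2 * L) * (1 / 2) ^ n / 2) by (simpl; field; lra).
  apply (integral_operator_contracts V F L _ x0 (picard F x0 (S n)) (picard F x0 n));
    auto using continuous_picard.
  apply Rmult_le_pos; [exact HK | apply pow_le; lra].
Qed.

(** The steps are bounded by a geometric series of ratio 1/2. *)
Lemma picard_tail (V : CompleteNormedModule R_AbsRing) (F : V -> V) (L : R)
    (x0 : V) :
  0 < L ->
  (forall a b, ndist (F a) (F b) <= L * ndist a b) ->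
  forall n k t,
    ndist (picard F x0 (n + k) t) (picard F x0 n t)
      <= norm (F x0) / L * (1 / 2) ^ n * exp (2 * L * Rmax 0 t).
Proof.
intros HL lip n k t.
apply Rle_trans with
  (norm (F x0) / L * (1 / 2) ^ n * (1 - (1 / 2) ^ k) * exp (2 * L * Rmax 0 t)).
- induction k as [|k IH].
  + rewrite Nat.add_0_r; rewrite ndist_diag; simpl; lra.
  + rewrite Nat.add_succ_r.
    apply Rle_trans with (1 := ndist_triangle V _ (picard F x0 (n + k) t) _).
    apply Rle_trans with (1 := Rplus_le_compat _ _ _ _ (picard_step V F L x0 HL lip (n + k) t) IH).
    apply Req_le; rewrite pow_add; simpl; field; lra.
- apply Rmult_le_compat_r; [apply Rlt_le, exp_pos|].
  assert (0 <= (1 / 2) ^ k) by (apply pow_le; lra).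
  assert (0 <= norm (F x0) / L * (1 / 2) ^ n).
  { apply Rmult_le_pos; [apply Rdiv_le_0_compat; [apply norm_ge_0 | lra] | apply pow_le; lra]. }
  nra.
Qed.

Lemma geom_small (C eps : R) : 0 < eps -> exists n, C * (1 / 2) ^ n < eps.
Proof.
intros He.
assert (H : is_lim_seq (fun n => C * (1 / 2) ^ n) (C * 0)).
{ apply is_lim_seq_mult'; [apply is_lim_seq_const|].
  apply is_lim_seq_geom; rewrite Rabs_pos_eq; lra. }
rewrite Rmult_0_r in H.
apply is_lim_seq_spec in H; destruct (H (mkposreal _ He)) as [N HN].
exists N; specialize (HN N (le_n N)); simpl in HN.
rewrite Rminus_0_r in HN; apply Rle_lt_trans with (1 := Rle_abs _) (2 := HN).
Qed.

Lemma picard_converges (V : CompleteNormedModule R_AbsRing) (F : V -> V) (L : R)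
    (x0 : V) :
  0 < L ->
  (forall a b, ndist (F a) (F b) <= L * ndist a b) ->
  exists x : R -> V, forall n t,
    ndist (x t) (picard F x0 n t)
      <= norm (F x0) / L * (1 / 2) ^ n * exp (2 * L * Rmax 0 t).
Proof.
intros HL lip.
assert (H : forall t, exists y, filterlim (fun n => picard F x0 n t) eventually (locally y)).
{ intros t.
  apply (proj1 (filterlim_locally_cauchy (F := eventually) (fun n => picard F x0 n t))).
  intros eps.
  destruct (geom_small (norm (F x0) / L * exp (2 * L * Rmax 0 t)) (eps / 2)) as [n Hn];
    [generalize (cond_pos eps); lra|].
  assert (B : forall m, (n <= m)%nat ->
    ndist (picard F x0 m t) (picard F x0 n t) < eps / 2).
  { intros m Hm; replace m with (n + (m - n))%nat by lia.
    apply Rle_lt_trans with (1 := picard_tail V F L x0 HL lip n (m - n) t); lra. }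
  exists (fun m => (n <= m)%nat); split; [now exists n|].
  intros u v Hu Hv; apply (norm_compat1 (V := V)).
  apply Rle_lt_trans with (1 := ndist_triangle V _ (picard F x0 n t) _).
  rewrite (ndist_sym V (picard F x0 n t)).
  generalize (B u Hu) (B v Hv); lra. }
destruct (functional_choice _ H) as [x Hx]; exists x; intros n t.
apply le_epsilon; intros e He.
destruct (proj1 (filterlim_ndist _ _) (Hx t) (mkposreal e He)) as [N HN].
specialize (HN (n + N)%nat ltac:(lia)); simpl in HN.
apply Rle_trans with (1 := ndist_triangle V _ (picard F x0 (n + N) t) _).
rewrite (ndist_sym V (x t)).
generalize (picard_tail V F L x0 HL lip n N t); lra.
Qed.

(** The iterates converge uniformly on every bounded interval, so their limit is
    continuous and is a fixed point of the integral operator. *)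
Theorem lipschitz_global_solution (V : CompleteNormedModule R_AbsRing)
    (F : V -> V) (L : R) (x0 : V) :
  0 < L ->
  (forall a b, ndist (F a) (F b) <= L * ndist a b) ->
  exists x : R -> V,
    x 0 = x0 /\ (forall t, continuous x t) /\
    forall t, 0 < t -> is_derive x t (F (x t)).
Proof.
intros HL lip.
assert (HF := lipschitz_continuous V F L HL lip).
assert (HK : 0 <= norm (F x0) / L)
  by (apply Rdiv_le_0_compat; [apply norm_ge_0 | lra]).
destruct (picard_converges V F L x0 HL lip) as [x Hx].
assert (Cx : forall t, continuous x t).
{ intros t; apply (proj2 (filterlim_ndist (V := V) x (x t))); intros eps.
  (* The weight at times within 1 of t is bounded by M. *)
  set (M := exp (2 * L * (Rmax 0 t + 1))).
  destruct (geom_small (norm (F x0) / L * M) (eps / 3)) as [n Hn];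
    [generalize (cond_pos eps); lra|].
  assert (He : 0 < eps / 3) by (generalize (cond_pos eps); lra).
  assert (B : forall s, Rabs (s - t) < 1 ->
    ndist (x s) (picard F x0 n s) < eps / 3).
  { intros s Hs; apply Rle_lt_trans with (1 := Hx n s).
    apply Rle_lt_trans with (2 := Hn).
    replace (norm (F x0) / L * M * (1 / 2) ^ n)
      with (norm (F x0) / L * (1 / 2) ^ n * M) by ring.
    apply Rmult_le_compat_l; [apply Rmult_le_pos; [exact HK | apply pow_le; lra]|].
    apply exp_le_compat, Rmult_le_compat_l; [lra|].
    revert Hs; unfold Rmax; destruct (Rle_dec 0 s), (Rle_dec 0 t);
      unfold Rabs; destruct Rcase_abs; lra. }
  assert (P := proj1 (filterlim_ndist _ _)
                 (continuous_picard V F x0 n HF t) (mkposreal _ He)).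
  assert (Q : locally t (fun s => Rabs (s - t) < 1))
    by (exists (mkposreal 1 Rlt_0_1); intros s Hs; exact Hs).
  generalize (filter_and _ _ P Q); apply filter_imp; intros s [H1 H2]; simpl in H1.
  apply Rle_lt_trans with (1 := ndist_triangle V _ (picard F x0 n s) _).
  assert (H3 := ndist_triangle V (picard F x0 n s) (picard F x0 n t) (x t)).
  rewrite (ndist_sym V (picard F x0 n t)) in H3.
  assert (H4 := B s H2).
  assert (H5 := B t ltac:(rewrite Rminus_diag, Rabs_R0; lra)).
  lra. }
assert (fixed : forall t,
  x t = plus x0 (RInt (fun s => F (x s)) 0 (Rmax 0 t))).
{ intros t.
  set (y := plus x0 _).
  assert (B : ndist (x t) y <= 0).
  { apply le_epsilon; intros e He; rewrite Rplus_0_l.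
    destruct (geom_small (norm (F x0) / L * exp (2 * L * Rmax 0 t)) e He) as [n Hn].
    apply Rlt_le, Rle_lt_trans with (2 := Hn).
    apply Rle_trans with (1 := ndist_triangle V _ (picard F x0 (S n) t) _).
    assert (A := Hx (S n) t).
    assert (D := integral_operator_contracts V F L
      (norm (F x0) / L * (1 / 2) ^ n) x0 x (picard F x0 n) HL
      ltac:(apply Rmult_le_pos; [exact HK | apply pow_le; lra]) lip Cx
      (continuous_picard V F x0 n HF) (Hx n) t).
    fold y in D; rewrite ndist_sym in D; simpl picard in A |- *; simpl pow in A.
    lra. }
  assert (Z := norm_eq_zero _ (Rle_antisym _ _ B (norm_ge_0 _))).
  apply (plus_reg_r (opp y)); rewrite plus_opp_r; exact Z. }
exists x; split; [|split; [exact Cx|]].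
- rewrite fixed, Rmax_left, RInt_point by lra; apply plus_zero_r.
- intros t Ht.
  apply (is_derive_ext_loc (K := R_AbsRing) (fun t => plus x0 (RInt (fun s => F (x s)) 0 t))).
  + exists (mkposreal t Ht); intros s Hs.
    change (Rabs (s - t) < t) in Hs.
    rewrite (fixed s), Rmax_right; [reflexivity|].
    revert Hs; unfold Rabs; destruct Rcase_abs; lra.
  + rewrite <- (plus_zero_l (F (x t))).
    apply (is_derive_plus (fun _ => x0)); [apply @is_derive_const|].
    apply (is_derive_primitive V (fun s => F (x s))).
    intros s; apply continuous_comp; auto.
Qed.

(** * Derivatives along forward solutions *)

(** Continuity on the half-line, one-sided at 0, is stated as continuity on the
    whole line of the function frozen at its initial value for negative times.
    This makes the two-sided theorems on continuous functions applicable and is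
    stable under algebraic operations. *)
Definition forward_derive {V : NormedModule R_AbsRing} (f df : R -> V) : Prop :=
  (forall t, continuous (fun s => f (Rmax 0 s)) t) /\
  forall t, 0 < t -> is_derive f t (df t).

Lemma solution_forward_derive (F : R3 -> R3) (u : R -> R3) :
  solution F u -> forward_derive u (fun t => F (u t)).
Proof.
intros [H0 Hd]; split; [intros t|exact Hd].
destruct (Rtotal_order t 0) as [Ht|[Ht|Ht]].
- apply (continuous_ext_loc _ (fun _ => u 0)); [|apply continuous_const].
  exists (mkposreal (- t) ltac:(lra)); intros s Hs; change (Rabs (s - t) < - t) in Hs.
  rewrite Rmax_left; [reflexivity|].
  revert Hs; unfold Rabs; destruct Rcase_abs; lra.
- subst t; intros P HP; rewrite Rmax_left in HP by lra.
  destruct (H0 P HP) as [e He]; exists e; intros s Hs.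
  destruct (Rle_or_lt s 0) as [H|H].
  + rewrite Rmax_left by lra; exact (locally_singleton _ _ HP).
  + rewrite Rmax_right by lra; exact (He s Hs H).
- apply (continuous_ext_loc _ u).
  + exists (mkposreal t Ht); intros s Hs; change (Rabs (s - t) < t) in Hs.
    rewrite Rmax_right; [reflexivity|].
    revert Hs; unfold Rabs; destruct Rcase_abs; lra.
  + exact (ex_derive_continuous u t (ex_intro _ (F (u t)) (Hd t Ht))).
Qed.

Lemma forward_derive_fst (U V : NormedModule R_AbsRing) (f df : R -> U * V) :
  forward_derive f df -> forward_derive (fun t => fst (f t)) (fun t => fst (df t)).
Proof.
intros [C D]; split; intros t.
- apply (continuous_comp (fun s => f (Rmax 0 s)) fst); [apply C|].
  apply continuous_fst.
- intros Ht; apply (filterdiff_comp' f fst t (fun y => scal y (df t)) fst (D t Ht)).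
  apply filterdiff_linear, is_linear_fst.
Qed.

Lemma forward_derive_snd (U V : NormedModule R_AbsRing) (f df : R -> U * V) :
  forward_derive f df -> forward_derive (fun t => snd (f t)) (fun t => snd (df t)).
Proof.
intros [C D]; split; intros t.
- apply (continuous_comp (fun s => f (Rmax 0 s)) snd); [apply C|].
  apply continuous_snd.
- intros Ht; apply (filterdiff_comp' f snd t (fun y => scal y (df t)) snd (D t Ht)).
  apply filterdiff_linear, is_linear_snd.
Qed.

Lemma forward_derive_plus (V : NormedModule R_AbsRing) (f g df dg : R -> V) :
  forward_derive f df -> forward_derive g dg ->
  forward_derive (fun t => plus (f t) (g t)) (fun t => plus (df t) (dg t)).
Proof.
intros [Cf Df] [Cg Dg]; split; intros t.
- apply (continuous_plus (fun s => f (Rmax 0 s)) (fun s => g (Rmax 0 s))); auto.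
- intros Ht; apply @is_derive_plus; auto.
Qed.

Lemma forward_derive_mult (f g df dg : R -> R) :
  forward_derive f df -> forward_derive g dg ->
  forward_derive (fun t => f t * g t) (fun t => df t * g t + f t * dg t).
Proof.
intros [Cf Df] [Cg Dg]; split; intros t.
- apply (continuous_mult (fun s => f (Rmax 0 s)) (fun s => g (Rmax 0 s))); auto.
- intros Ht; apply (is_derive_mult (K := R_AbsRing) f g t); auto.
  exact Rmult_comm.
Qed.

Lemma forward_derive_const (V : NormedModule R_AbsRing) (c : V) :
  forward_derive (fun _ => c) (fun _ => zero).
Proof.
split; intros t; [apply continuous_const | intros _; apply @is_derive_const].
Qed.

Lemma forward_derive_ext (V : NormedModule R_AbsRing) (f g df dg : R -> V) :
  (forall t, f t = g t) -> (forall t, df t = dg t) ->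
  forward_derive f df -> forward_derive g dg.
Proof.
intros Hfg Hd [C D]; split; intros t.
- apply (continuous_ext (fun s => f (Rmax 0 s))); [intros s; apply Hfg | apply C].
- intros Ht; rewrite <- Hd.
  apply (is_derive_ext (K := R_AbsRing) f); [exact Hfg | exact (D t Ht)].
Qed.

(** f(t) exp(k t) has nonpositive derivative. *)
Lemma gronwall_decay (f df : R -> R) (k : R) :
  forward_derive f df ->
  (forall t, 0 < t -> df t <= - k * f t) ->
  forall t, 0 <= t -> f t <= f 0 * exp (- k * t).
Proof.
intros Hf Hle t [Ht|<-]; [|rewrite Rmult_0_r, exp_0; lra].
assert (He : forward_derive (fun s => exp (k * s)) (fun s => k * exp (k * s))).
{ split; intros s.
  - apply (continuous_comp (Rmax 0) (fun s => exp (k * s))).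
    + apply continuous_Rmax_0.
    + apply (ex_derive_continuous (fun s => exp (k * s))); auto_derive; easy.
  - intros _; auto_derive; [easy | ring]. }
destruct (forward_derive_mult _ _ _ _ Hf He) as [C D].
set (g := fun s => f s * exp (k * s)) in C, D.
(* The intermediate point may be 0, where no derivative is available: there the
   candidate derivative is given the harmless value 0. *)
destruct (MVT_gen (fun s => g (Rmax 0 s)) 0 t
  (fun s => if Rlt_dec 0 s
            then df s * exp (k * s) + f s * (k * exp (k * s)) else 0))
  as [c [_ Hc]].
- intros s Hs; rewrite Rmin_left in Hs by lra.
  destruct (Rlt_dec 0 s) as [H|H]; [|lra].
  apply (is_derive_ext_loc (K := R_AbsRing) g); [|now apply D].
  exists (mkposreal s H); intros r Hr; change (Rabs (r - s) < s) in Hr.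
  rewrite Rmax_right; [reflexivity|].
  revert Hr; unfold Rabs; destruct Rcase_abs; lra.
- intros s _; apply continuity_pt_filterlim, C.
- rewrite (Rmax_right 0 t), (Rmax_left 0 0) in Hc by lra.
  assert (Hg : g t <= g 0).
  { apply Rminus_le; rewrite Hc; destruct (Rlt_dec 0 c) as [H|H]; [|lra].
    assert (E := exp_pos (k * c)); specialize (Hle c H).
    replace (df c * exp (k * c) + f c * (k * exp (k * c)))
      with ((df c + k * f c) * exp (k * c)) by ring.
    assert (0 <= (- (df c + k * f c)) * exp (k * c) * t)
      by (repeat apply Rmult_le_pos; lra).
    lra. }
  unfold g in Hg; rewrite Rmult_0_r, exp_0, Rmult_1_r in Hg.
  apply Rmult_le_reg_r with (exp (k * t)); [apply exp_pos|].
  rewrite Rmult_assoc, <- exp_plus.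
  replace (- k * t + k * t) with 0 by ring; rewrite exp_0; lra.
Qed.

Lemma forward_derive_0_const (f df : R -> R) :
  forward_derive f df -> (forall t, 0 < t -> df t = 0) ->
  forall t, 0 <= t -> f t = f 0.
Proof.
intros Hf H0 t Ht.
assert (A := gronwall_decay f df 0 Hf ltac:(intros s Hs; rewrite H0; lra) t Ht).
assert (Hm := forward_derive_mult _ _ _ _ (forward_derive_const _ (-1)) Hf).
assert (B := gronwall_decay _ _ 0 Hm
  ltac:(intros s Hs; simpl; rewrite (H0 s Hs); unfold zero; simpl; lra) t Ht).
simpl in B; rewrite Ropp_0, Rmult_0_l, exp_0 in A, B; lra.
Qed.

(** A change of sign would produce a zero. *)
Lemma forward_derive_pos (f df : R -> R) :
  forward_derive f df -> 0 < f 0 -> (forall t, 0 <= t -> f t <> 0) ->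
  forall t, 0 <= t -> 0 < f t.
Proof.
intros [C _] H0 Hn t Ht.
destruct (Rlt_or_le 0 (f t)) as [H|H]; [exact H|exfalso].
destruct (IVT_cor (fun s => f (Rmax 0 s)) 0 t) as [z [Hz Ez]].
- intros s; apply continuity_pt_filterlim, C.
- exact Ht.
- rewrite (Rmax_right 0 t), (Rmax_left 0 0) by lra; nra.
- exact (Hn _ (Rmax_l 0 z) Ez).
Qed.

(** * Global existence for the system in u *)

(** Boundedness is included because a product of Lipschitz functions need not be
    Lipschitz without it; with it the class is an algebra, so polynomials in
    functions of the class belong to it. *)
Definition bounded_lipschitz {V : NormedModule R_AbsRing} (f : V -> R) : Prop :=
  exists C, 0 <= C /\ (forall u, Rabs (f u) <= C) /\
    forall u v, Rabs (f u - f v) <= C * ndist u v.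

Lemma ndist_ge_0 (V : NormedModule R_AbsRing) (u v : V) : 0 <= ndist u v.
Proof. apply norm_ge_0. Qed.

Lemma bounded_lipschitz_const (V : NormedModule R_AbsRing) (c : R) :
  bounded_lipschitz (fun _ : V => c).
Proof.
exists (Rabs c); split; [apply Rabs_pos|]; split; [intros; lra|].
intros u v; rewrite Rminus_diag, Rabs_R0.
apply Rmult_le_pos; [apply Rabs_pos | apply ndist_ge_0].
Qed.

Lemma bounded_lipschitz_plus (V : NormedModule R_AbsRing) (f g : V -> R) :
  bounded_lipschitz f -> bounded_lipschitz g ->
  bounded_lipschitz (fun u => f u + g u).
Proof.
intros [C [HC [Bf Lf]]] [C' [HC' [Bg Lg]]]; exists (C + C'); split; [lra|].
split; [intros u | intros u v].
- apply Rle_trans with (1 := Rabs_triang _ _); generalize (Bf u) (Bg u); lra.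
- replace (f u + g u - (f v + g v)) with ((f u - f v) + (g u - g v)) by ring.
  apply Rle_trans with (1 := Rabs_triang _ _); generalize (Lf u v) (Lg u v); lra.
Qed.

Lemma bounded_lipschitz_mult (V : NormedModule R_AbsRing) (f g : V -> R) :
  bounded_lipschitz f -> bounded_lipschitz g ->
  bounded_lipschitz (fun u => f u * g u).
Proof.
intros [C [HC [Bf Lf]]] [C' [HC' [Bg Lg]]]; exists (2 * (C * C')).
assert (0 <= C * C') by now apply Rmult_le_pos.
split; [lra|]; split; [intros u | intros u v].
- rewrite Rabs_mult.
  assert (Rabs (f u) * Rabs (g u) <= C * C')
    by (apply Rmult_le_compat; auto using Rabs_pos).
  lra.
- replace (f u * g u - f v * g v) with ((f u - f v) * g u + f v * (g u - g v)) by ring.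
  apply Rle_trans with (1 := Rabs_triang _ _); rewrite !Rabs_mult.
  assert (A : Rabs (f u - f v) * Rabs (g u) <= C * ndist u v * C')
    by (apply Rmult_le_compat; auto using Rabs_pos).
  assert (B : Rabs (f v) * Rabs (g u - g v) <= C * (C' * ndist u v))
    by (apply Rmult_le_compat; auto using Rabs_pos).
  lra.
Qed.

Lemma bounded_lipschitz_opp (V : NormedModule R_AbsRing) (f : V -> R) :
  bounded_lipschitz f -> bounded_lipschitz (fun u => - f u).
Proof.
intros [C [HC [Bf Lf]]]; exists C; split; [exact HC|]; split; [intros u | intros u v].
- rewrite Rabs_Ropp; apply Bf.
- replace (- f u - - f v) with (- (f u - f v)) by ring; rewrite Rabs_Ropp; apply Lf.
Qed.

Lemma bounded_lipschitz_minus (V : NormedModule R_AbsRing) (f g : V -> R) :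
  bounded_lipschitz f -> bounded_lipschitz g ->
  bounded_lipschitz (fun u => f u - g u).
Proof.
intros; apply bounded_lipschitz_plus, bounded_lipschitz_opp; assumption.
Qed.

Lemma bounded_lipschitz_sqr (V : NormedModule R_AbsRing) (f : V -> R) :
  bounded_lipschitz f -> bounded_lipschitz (fun u => f u ^ 2).
Proof.
intros Hf; apply bounded_lipschitz_mult; [exact Hf|].
apply bounded_lipschitz_mult; [exact Hf | apply bounded_lipschitz_const].
Qed.

(** Multiplying u by this factor is the radial retraction onto the ball of
    radius M. *)
Definition clip_factor {V : NormedModule R_AbsRing} (M : R) (u : V) : R :=
  M / Rmax M (norm u).

(** With m(u) the larger of M and the norm of u, which is a 1-Lipschitz function,
    a(u) / m(u) - a(v) / m(v) is split into the variation of a, and the variation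
    of m times the bounded quotient a(v) / m(v). *)
Lemma clip_bounded_lipschitz (V : NormedModule R_AbsRing) (M : R) (a : V -> R) :
  0 < M -> (forall u, Rabs (a u) <= norm u) ->
  (forall u v, Rabs (a u - a v) <= ndist u v) ->
  bounded_lipschitz (fun u => clip_factor M u * a u).
Proof.
intros HM Ha La; exists (M + 2); split; [lra|]; unfold clip_factor.
assert (Hm : forall u : V, M <= Rmax M (norm u) /\ norm u <= Rmax M (norm u))
  by (split; [apply Rmax_l | apply Rmax_r]).
split; [intros u | intros u v].
- destruct (Hm u) as [m1 m2].
  rewrite Rabs_mult, (Rabs_pos_eq (M / _)) by (apply Rdiv_le_0_compat; lra).
  apply Rle_trans with M; [|lra].
  apply Rmult_le_reg_r with (Rmax M (norm u)); [lra|].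
  field_simplify; [|lra].
  apply Rmult_le_compat_l; [lra|]; apply Rle_trans with (1 := Ha u); lra.
- destruct (Hm u) as [m1 m2], (Hm v) as [n1 n2].
  assert (Hd : Rabs (Rmax M (norm u) - Rmax M (norm v)) <= ndist u v).
  { apply Rle_trans with (2 := norm_triangle_inv u v).
    unfold Rmax; destruct (Rle_dec M (norm u)), (Rle_dec M (norm v));
      unfold Rabs; repeat destruct Rcase_abs; lra. }
  assert (L1 := La u v); assert (L2 := Ha v); assert (D := ndist_ge_0 V u v).
  set (m := Rmax M (norm u)) in *; set (n := Rmax M (norm v)) in *.
  replace (M / m * a u - M / n * a v)
    with (M / m * ((a u - a v) + (n - m) * (a v / n))) by (field; lra).
  rewrite Rabs_mult, (Rabs_pos_eq (M / m)) by (apply Rdiv_le_0_compat; lra).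
  assert (F1 : M / m <= 1)
    by (apply Rmult_le_reg_r with m; [lra|]; field_simplify; lra).
  assert (F2 : Rabs (a v / n) <= 1).
  { unfold Rdiv; rewrite Rabs_mult, (Rabs_pos_eq (/ n))
      by (apply Rlt_le, Rinv_0_lt_compat; lra).
    apply Rmult_le_reg_r with n; [lra|]; field_simplify; lra. }
  assert (F3 : Rabs ((a u - a v) + (n - m) * (a v / n)) <= 2 * ndist u v).
  { apply Rle_trans with (1 := Rabs_triang _ _); rewrite Rabs_mult.
    rewrite Rabs_minus_sym in Hd.
    assert (Rabs (n - m) * Rabs (a v / n) <= ndist u v * 1)
      by (apply Rmult_le_compat; auto using Rabs_pos).
    lra. }
  apply Rle_trans with (1 * (2 * ndist u v)).
  + apply Rmult_le_compat; auto using Rabs_pos; apply Rdiv_le_0_compat; lra.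
  + assert (0 <= M * ndist u v) by (apply Rmult_le_pos; lra); lra.
Qed.

Lemma norm_prod_le_sum (U V : NormedModule R_AbsRing) (x : U) (y : V) :
  norm (x, y) <= 2 * (norm x + norm y).
Proof.
apply Rle_trans with (1 := proj2 (norm_prod x y)).
apply Rmult_le_compat.
- apply sqrt_pos.
- apply Rle_trans with (1 := norm_ge_0 x), Rmax_l.
- apply Rlt_le, Rsqr_incrst_0; [|apply sqrt_pos|lra].
  rewrite Rsqr_sqrt; unfold Rsqr; lra.
- apply Rmax_lub; generalize (norm_ge_0 x) (norm_ge_0 y); lra.
Qed.

Lemma norm_R3_le (a b c : R) :
  norm ((a, b, c) : R3) <= 4 * Rabs a + 4 * Rabs b + 2 * Rabs c.
Proof.
assert (A : norm ((a, b) : R * R) <= 2 * (Rabs a + Rabs b))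
  by exact (norm_prod_le_sum R_NormedModule R_NormedModule a b).
assert (B : norm ((a, b, c) : R3) <= 2 * (norm ((a, b) : R * R) + Rabs c))
  by exact (norm_prod_le_sum (prod_NormedModule R_AbsRing R_NormedModule R_NormedModule)
              R_NormedModule (a, b) c).
lra.
Qed.

Lemma lipschitz_components (V : NormedModule R_AbsRing) (f1 f2 f3 : V -> R) :
  bounded_lipschitz f1 -> bounded_lipschitz f2 -> bounded_lipschitz f3 ->
  exists L, 0 < L /\
    forall u v, ndist ((f1 u, f2 u, f3 u) : R3) (f1 v, f2 v, f3 v) <= L * ndist u v.
Proof.
intros [C1 [H1 [_ L1]]] [C2 [H2 [_ L2]]] [C3 [H3 [_ L3]]].
exists (4 * C1 + 4 * C2 + 2 * C3 + 1); split; [lra|]; intros u v.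
assert (D := ndist_ge_0 V u v).
apply Rle_trans with (1 := norm_R3_le (f1 u - f1 v) (f2 u - f2 v) (f3 u - f3 v)).
generalize (L1 u v) (L2 u v) (L3 u v); lra.
Qed.

Definition clip3 (M : R) (u : R3) : R3 :=
  let c := clip_factor M u in
  let '(u1, u2, u3) := u in (c * u1, c * u2, c * u3).

Lemma norm3_le (u : R3) :
  let '(u1, u2, u3) := u in
  Rabs u1 <= norm u /\ Rabs u2 <= norm u /\ Rabs u3 <= norm u.
Proof.
destruct u as [[u1 u2] u3].
assert (A : Rmax (Rabs u1) (Rabs u2) <= norm ((u1, u2) : R * R))
  by exact (proj1 (norm_prod (U := R_NormedModule) (V := R_NormedModule) u1 u2)).
assert (B : Rmax (norm ((u1, u2) : R * R)) (Rabs u3) <= norm ((u1, u2, u3) : R3))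
  by exact (proj1 (norm_prod (U := prod_NormedModule R_AbsRing R_NormedModule R_NormedModule)
                     (V := R_NormedModule) (u1, u2) u3)).
generalize (Rmax_l (Rabs u1) (Rabs u2)) (Rmax_r (Rabs u1) (Rabs u2))
  (Rmax_l (norm ((u1, u2) : R * R)) (Rabs u3))
  (Rmax_r (norm ((u1, u2) : R * R)) (Rabs u3)); lra.
Qed.

Lemma norm_sqr_Psi (u : R3) : norm u ^ 2 = Psi u.
Proof.
destruct u as [[u1 u2] u3].
change (sqrt (sqrt (Rabs u1 ^ 2 + Rabs u2 ^ 2) ^ 2 + Rabs u3 ^ 2) ^ 2
        = u1 ^ 2 + u2 ^ 2 + u3 ^ 2).
assert (H1 := pow2_ge_0 (Rabs u1)); assert (H2 := pow2_ge_0 (Rabs u2)).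
assert (H3 := pow2_ge_0 (Rabs u3)).
rewrite (pow2_sqrt (Rabs u1 ^ 2 + Rabs u2 ^ 2)), pow2_sqrt by lra.
now rewrite !pow2_abs.
Qed.

Lemma clip3_id (M : R) (u : R3) : 0 < M -> norm u <= M -> clip3 M u = u.
Proof.
intros HM Hu; unfold clip3, clip_factor; rewrite Rmax_left by exact Hu.
destruct u as [[u1 u2] u3]; unfold Rdiv; rewrite Rinv_r by lra.
now rewrite !Rmult_1_l.
Qed.

Lemma bounded_lipschitz_clip3 (M : R) :
  0 < M ->
  bounded_lipschitz (fun u : R3 => fst (fst (clip3 M u))) /\
  bounded_lipschitz (fun u : R3 => snd (fst (clip3 M u))) /\
  bounded_lipschitz (fun u : R3 => snd (clip3 M u)).
Proof.
intros HM.
assert (P : forall a : R3 -> R,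
  (forall u, Rabs (a u) <= norm u) ->
  (forall u v, a u - a v = a (minus u v)) ->
  bounded_lipschitz (fun u => clip_factor M u * a u)).
{ intros a Ha La; apply clip_bounded_lipschitz; [exact HM | exact Ha |].
  intros u v; rewrite La; apply Ha. }
assert (E : forall f g : R3 -> R, (forall u, f u = g u) ->
  bounded_lipschitz f -> bounded_lipschitz g).
{ intros f g Hfg [C [HC [Bf Lf]]]; exists C; split; [exact HC|].
  split; [intros u; rewrite <- Hfg; apply Bf | intros u v; rewrite <- !Hfg; apply Lf]. }
split; [|split];
  [ apply (E (fun u => clip_factor M u * fst (fst u)))
  | apply (E (fun u => clip_factor M u * snd (fst u)))
  | apply (E (fun u => clip_factor M u * snd u)) ];
  try (intros [[u1 u2] u3]; reflexivity);
  apply P; try (intros [[u1 u2] u3] [[v1 v2] v3]; reflexivity);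
  intros u; generalize (norm3_le u); destruct u as [[u1 u2] u3]; simpl; tauto.
Qed.

(** This is the conservation of Psi in infinitesimal form. *)
Lemma field_tangent (D1 D2 D3 Omega alpha : R) (u : R3) :
  fst (fst u) * fst (fst (field D1 D2 D3 Omega alpha u)) +
  snd (fst u) * snd (fst (field D1 D2 D3 Omega alpha u)) +
  snd u * snd (field D1 D2 D3 Omega alpha u) = 0.
Proof. destruct u as [[u1 u2] u3]; simpl; ring. Qed.

(** The clipped point is a positive multiple of u, and the field is orthogonal to
    the clipped point. *)
Lemma clipped_field_tangent (D1 D2 D3 Omega alpha M : R) (u : R3) :
  0 < M ->
  fst (fst u) * fst (fst (field D1 D2 D3 Omega alpha (clip3 M u))) +
  snd (fst u) * snd (fst (field D1 D2 D3 Omega alpha (clip3 M u))) +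
  snd u * snd (field D1 D2 D3 Omega alpha (clip3 M u)) = 0.
Proof.
intros HM.
assert (Hc : 0 < clip_factor M u).
{ apply Rdiv_lt_0_compat; [exact HM|].
  apply Rlt_le_trans with (1 := HM), Rmax_l. }
assert (T := field_tangent D1 D2 D3 Omega alpha (clip3 M u)).
apply Rmult_eq_reg_l with (clip_factor M u); [|lra].
rewrite Rmult_0_r, <- T; destruct u as [[u1 u2] u3].
change (clip3 M (u1, u2, u3)) with
  (clip_factor M (u1, u2, u3) * u1, clip_factor M (u1, u2, u3) * u2,
   clip_factor M (u1, u2, u3) * u3); simpl fst; simpl snd; ring.
Qed.

Lemma Psi_conserved (u du : R -> R3) :
  forward_derive u du ->
  (forall t, 0 < t ->
     fst (fst (u t)) * fst (fst (du t)) + snd (fst (u t)) * snd (fst (du t)) +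
     snd (u t) * snd (du t) = 0) ->
  forall t, 0 <= t -> Psi (u t) = Psi (u 0).
Proof.
intros Hu H0.
assert (E : forall v : R3, fst (fst v) * fst (fst v) + snd (fst v) * snd (fst v)
                           + snd v * snd v = Psi v)
  by (intros [[v1 v2] v3]; simpl; ring).
intros t Ht; rewrite <- !E; revert t Ht.
assert (H12 := forward_derive_fst _ _ _ _ Hu).
assert (H1 := forward_derive_fst _ _ _ _ H12).
assert (H2 := forward_derive_snd _ _ _ _ H12).
assert (H3 := forward_derive_snd _ _ _ _ Hu).
apply (forward_derive_0_const _ _
  (forward_derive_plus _ _ _ _ _
    (forward_derive_plus _ _ _ _ _ (forward_derive_mult _ _ _ _ H1 H1)
                                   (forward_derive_mult _ _ _ _ H2 H2))
    (forward_derive_mult _ _ _ _ H3 H3))).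
intros t Ht; specialize (H0 t Ht); unfold plus; simpl; lra.
Qed.

(** The components of the clipped field are polynomials in bounded Lipschitz
    functions. *)
Lemma clipped_field_lipschitz (D1 D2 D3 Omega alpha M : R) :
  0 < M ->
  exists L, 0 < L /\ forall u v : R3,
    ndist (field D1 D2 D3 Omega alpha (clip3 M u))
          (field D1 D2 D3 Omega alpha (clip3 M v)) <= L * ndist u v.
Proof.
intros HM; destruct (bounded_lipschitz_clip3 M HM) as [B1 [B2 B3]].
assert (E : forall u : R3, field D1 D2 D3 Omega alpha (clip3 M u) =
  field D1 D2 D3 Omega alpha
    (fst (fst (clip3 M u)), snd (fst (clip3 M u)), snd (clip3 M u)))
  by (intros [[u1 u2] u3]; reflexivity).
edestruct (lipschitz_components
  (prod_NormedModule R_AbsRing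
    (prod_NormedModule R_AbsRing R_NormedModule R_NormedModule) R_NormedModule))
  as [L [HL H]];
  [| | | exists L; split; [exact HL | intros u v; rewrite !E; exact (H u v)]];
repeat first
  [ exact B1 | exact B2 | exact B3
  | apply bounded_lipschitz_plus | apply bounded_lipschitz_minus
  | apply bounded_lipschitz_sqr
  | apply bounded_lipschitz_mult | apply bounded_lipschitz_opp
  | apply bounded_lipschitz_const ].
Qed.

(** The solution of the clipped system stays on the sphere of its initial value,
    which lies inside the ball where clipping is the identity. *)
Theorem field_global_solution (D1 D2 D3 Omega alpha : R) (u0 : R3) :
  exists u, solution (field D1 D2 D3 Omega alpha) u /\ u 0 = u0.
Proof.
set (M := norm u0 + 1).
assert (HM : 0 < M) by (generalize (norm_ge_0 u0); unfold M; lra).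
destruct (clipped_field_lipschitz D1 D2 D3 Omega alpha M HM) as [L [HL lip]].
destruct (lipschitz_global_solution
  (prod_CompleteNormedModule R_AbsRing
    (prod_CompleteNormedModule R_AbsRing R_CompleteNormedModule R_CompleteNormedModule)
    R_CompleteNormedModule)
  (fun u => field D1 D2 D3 Omega alpha (clip3 M u)) L u0 HL lip) as [u [H0 [C D]]].
assert (S : solution (fun u => field D1 D2 D3 Omega alpha (clip3 M u)) u).
{ split; [|exact D].
  apply filterlim_filter_le_1 with (2 := C 0), filter_le_within. }
assert (P := Psi_conserved u _ (solution_forward_derive _ _ S)
  (fun t _ => clipped_field_tangent D1 D2 D3 Omega alpha M (u t) HM)).
exists u; split; [split; [exact (proj1 S)|] | exact H0].
intros t Ht; rewrite <- (clip3_id M (u t) HM); [exact (D t Ht)|].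
apply Rle_trans with (norm u0); [|unfold M; lra].
apply Rsqr_incr_0; [|apply norm_ge_0|apply norm_ge_0].
rewrite !Rsqr_pow2, !norm_sqr_Psi, P by lra; rewrite H0; lra.
Qed.

(** * Decay of W and convergence *)

Lemma filterlim_prod {T : Type} {U V : UniformSpace} {G : (T -> Prop) -> Prop}
    {FG : Filter G} (f : T -> U * V) (a : U) (b : V) :
  filterlim (fun t => fst (f t)) G (locally a) ->
  filterlim (fun t => snd (f t)) G (locally b) ->
  filterlim f G (locally (a, b)).
Proof.
intros Ha Hb; apply filterlim_locally; intros eps.
assert (A := proj1 (filterlim_locally _ _) Ha eps).
assert (B := proj1 (filterlim_locally _ _) Hb eps).
generalize (filter_and _ _ A B); apply filter_imp; intros t [H1 H2]; now split.
Qed.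

Lemma is_lim_0_of_sqr_le_exp (f : R -> R) (C k : R) :
  0 < k -> (forall t, 0 <= t -> f t ^ 2 <= C * exp (- k * t)) ->
  is_lim f p_infty 0.
Proof.
intros Hk Hf.
assert (E : is_lim (fun t => sqrt (C * exp (- k * t))) p_infty 0).
{ rewrite <- sqrt_0, <- (Rmult_0_r C).
  apply (is_lim_comp_continuous (fun t => exp (- k * t)) (fun y => sqrt (C * y)) p_infty 0).
  - apply (is_lim_comp exp (fun t => - k * t) p_infty 0 m_infty is_lim_exp_m).
    + replace m_infty with (Rbar_mult (- k) p_infty).
      * apply is_lim_scal_l, is_lim_id.
      * simpl; destruct (Rle_dec 0 (- k)) as [H|H]; [exfalso; lra | reflexivity].
    + exists 0; discriminate.
  - apply continuous_comp with (f := fun y => C * y) (g := sqrt).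
    + apply (continuous_mult (fun _ => C) (fun y => y));
        [apply continuous_const | apply continuous_id].
    + apply continuous_sqrt. }
apply (is_lim_le_le_loc (fun t => - sqrt (C * exp (- k * t)))
                        (fun t => sqrt (C * exp (- k * t)))).
- exists 0; intros t Ht; apply Rabs_le_between; rewrite <- sqrt_Rsqr_abs, Rsqr_pow2.
  apply sqrt_le_1_alt, Hf; lra.
- rewrite <- Ropp_0; exact (is_lim_opp _ p_infty 0 E).
- exact E.
Qed.

(** The hypotheses on the parameters, free of quotients and roots.  The second one
    bounds gamma below by a positive number, which forces Omega < 1. *)
Lemma parameter_bounds (D1 D2 D3 Omega : R) :
  D1 < D2 -> D2 < D3 -> 0 < Omega ->
  3 * Omega ^ 2 >= 2 * (D2 - D1) / (D3 - D1) ->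
  16 * sqrt ((D2 - D1) / (D3 - D1)) <= gam Omega ->
  0 < gam Omega /\ gam Omega ^ 2 = 1 - Omega ^ 2 /\
  2 * (D2 - D1) <= 3 * Omega ^ 2 * (D3 - D1) /\
  256 * (D2 - D1) <= gam Omega ^ 2 * (D3 - D1).
Proof.
intros H12 H23 HO H1 H2.
assert (Hr : 0 < (D2 - D1) / (D3 - D1)) by (apply Rdiv_lt_0_compat; lra).
assert (Hs := sqrt_lt_R0 _ Hr).
assert (Hg : 0 < gam Omega) by lra.
split; [exact Hg|]; split; [|split].
- unfold gam; apply pow2_sqrt.
  destruct (Rle_or_lt 0 (1 - Omega ^ 2)) as [H|H]; [exact H|].
  unfold gam in Hg; rewrite sqrt_neg_0 in Hg; lra.
- apply Rge_le in H1.
  apply (Rmult_le_compat_r (D3 - D1)) in H1; [|lra].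
  replace (2 * (D2 - D1) / (D3 - D1) * (D3 - D1)) with (2 * (D2 - D1)) in H1
    by (field; lra).
  lra.
- assert (H3 : (16 * sqrt ((D2 - D1) / (D3 - D1))) ^ 2 <= gam Omega ^ 2)
    by (apply pow_incr; lra).
  rewrite Rpow_mult_distr, pow2_sqrt in H3 by lra.
  apply (Rmult_le_compat_r (D3 - D1)) in H3; [|lra].
  replace (16 ^ 2 * ((D2 - D1) / (D3 - D1)) * (D3 - D1)) with (256 * (D2 - D1)) in H3
    by (field; lra).
  lra.
Qed.

(** On the sublevel set, 16 q O^2 (x^2 + y^2) <= p g^2.  With 2 p <= 3 O^2 q this
    gives x^2 + y^2 <= (3/32) g^2, and with 256 p <= g^2 q it gives
    64 O |x| <= g^2.  Together with |d| <= g^2 / 16 the perturbation of g^2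
    is at least -(3/16) g^2 and at most (3/32) g^2. *)
Lemma energy_sublevel_bounds (p q O g d x y : R) :
  0 < p -> p < q -> 0 < O -> 0 < g ->
  2 * p <= 3 * O ^ 2 * q -> 256 * p <= g ^ 2 * q ->
  Rabs d <= (g / 4) ^ 2 ->
  / 2 * (p * x ^ 2 + q * y ^ 2) <= (p * g) ^ 2 / (32 * q * O ^ 2) ->
  (3 / 4 * g) ^ 2 <= g ^ 2 + d + 2 * O * x - x ^ 2 - y ^ 2 <= (5 / 4 * g) ^ 2.
Proof.
intros Hp Hpq HO Hg H1 H2 Hd HW.
apply Rabs_le_between in Hd.
assert (HO2 : 0 < O ^ 2) by now apply pow_lt.
assert (Hg2 : 0 < g ^ 2) by now apply pow_lt.
assert (HqO : 0 < q * O ^ 2) by (apply Rmult_lt_0_compat; lra).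
assert (Hx := pow2_ge_0 x); assert (Hy := pow2_ge_0 y).
assert (S : 16 * q * O ^ 2 * (x ^ 2 + y ^ 2) <= p * g ^ 2).
{ apply Rmult_le_reg_l with p; [lra|].
  apply (Rmult_le_compat_r (32 * (q * O ^ 2))) in HW; [|lra].
  replace ((p * g) ^ 2 / (32 * q * O ^ 2) * (32 * (q * O ^ 2)))
    with (p * (p * g ^ 2)) in HW by (field; lra).
  apply Rle_trans with (2 := HW).
  assert (0 <= (q * O ^ 2) * ((q - p) * y ^ 2))
    by (apply Rmult_le_pos; [lra | apply Rmult_le_pos; lra]).
  lra. }
assert (S1 : x ^ 2 + y ^ 2 <= 3 / 32 * g ^ 2).
{ apply Rmult_le_reg_l with (16 * q * O ^ 2); [lra|].
  apply Rle_trans with (1 := S).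
  apply (Rmult_le_compat_r (g ^ 2)) in H1; lra. }
assert (S2 : (64 * (O * x)) ^ 2 <= (g ^ 2) ^ 2).
{ apply Rmult_le_reg_l with q; [lra|].
  assert (0 <= q * O ^ 2 * y ^ 2) by (apply Rmult_le_pos; lra).
  apply (Rmult_le_compat_r (g ^ 2)) in H2; lra. }
assert (S3 : Rabs (64 * (O * x)) <= g ^ 2).
{ rewrite <- (Rabs_pos_eq (g ^ 2)) by lra; apply Rsqr_le_abs_0.
  rewrite !Rsqr_pow2; exact S2. }
apply Rabs_le_between in S3; lra.
Qed.

(** With V2 = u2 + Omega, the terms without alpha are - q u1 u3 in V2' and p u1 V2
    in u3'; the weights p and q of W make their contributions cancel.  In the
    dissipative part the factor of u3^2 is a perfect square plus q^2 u1^2. *)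
Lemma W_dissipation (D1 D2 D3 Omega alpha : R) (u : R3) :
  let '(u1, u2, u3) := u in
  let '(_, f2, f3) := field D1 D2 D3 Omega alpha u in
  (D2 - D1) * (u2 + Omega) * f2 + (D3 - D1) * u3 * f3 =
  - alpha * ((D2 - D1) ^ 2 * u1 ^ 2 * (u2 + Omega) ^ 2 +
             u3 ^ 2 * (((D3 - D2) * (u2 + Omega) - (D3 - D1) * Omega) ^ 2
                       + (D3 - D1) ^ 2 * u1 ^ 2)).
Proof. destruct u as [[u1 u2] u3]; simpl; unfold h2; ring. Qed.

(** The square not containing u1 is dropped, and q^2 is bounded below by p q. *)
Lemma W_dissipation_le (D1 D2 D3 Omega alpha : R) (u : R3) :
  D1 < D2 -> D2 < D3 -> 0 < alpha ->
  let '(u1, u2, u3) := u in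
  let '(_, f2, f3) := field D1 D2 D3 Omega alpha u in
  (D2 - D1) * (u2 + Omega) * f2 + (D3 - D1) * u3 * f3 <=
  - (2 * alpha * (D2 - D1) * u1 ^ 2) * W D1 D2 D3 (u2 + Omega) u3.
Proof.
intros H12 H23 Ha; generalize (W_dissipation D1 D2 D3 Omega alpha u).
destruct u as [[u1 u2] u3]; cbn [field]; intros ->; unfold W.
set (p := D2 - D1); set (q := D3 - D1); set (z := (D3 - D2) * _ - _).
assert (A : 0 <= alpha * (u3 ^ 2 * z ^ 2))
  by (apply Rmult_le_pos; [lra | apply Rmult_le_pos; apply pow2_ge_0]).
assert (B : 0 <= (q * (q - p)) * (alpha * (u1 ^ 2 * u3 ^ 2))).
{ apply Rmult_le_pos; [apply Rmult_le_pos; unfold p, q; lra|].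
  apply Rmult_le_pos; [lra | apply Rmult_le_pos; apply pow2_ge_0]. }
lra.
Qed.

(** The sign of u1 at time 0 decides between the limit
    (sqrt (gamma^2 + d), - Omega, 0) and its mirror image with u1 < 0. *)
Lemma field_converges (D1 D2 D3 Omega alpha d : R) (u : R -> R3) :
  D1 < D2 -> D2 < D3 -> 0 < Omega ->
  3 * Omega ^ 2 >= 2 * (D2 - D1) / (D3 - D1) ->
  16 * sqrt ((D2 - D1) / (D3 - D1)) <= gam Omega ->
  0 < alpha -> Rabs d <= (gam Omega / 4) ^ 2 ->
  solution (field D1 D2 D3 Omega alpha) u ->
  0 < fst (fst (u 0)) -> Psi (u 0) = 1 + d ->
  W D1 D2 D3 (snd (fst (u 0)) + Omega) (snd (u 0))
    <= ((D2 - D1) * gam Omega) ^ 2 / (32 * (D3 - D1) * Omega ^ 2) ->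
  filterlim u (Rbar_locally p_infty)
    (locally ((sqrt (gam Omega ^ 2 + d), - Omega, 0) : R3)).
Proof.
intros H12 H23 HO Hyp1 Hyp2 Ha Hd Hu Hpos HPsi HW.
destruct (parameter_bounds _ _ _ _ H12 H23 HO Hyp1 Hyp2) as [Hg [Eg [Hq1 Hq2]]].
set (g := gam Omega) in *; set (W0 := _ / _) in HW.
assert (HG := solution_forward_derive _ _ Hu).
assert (H12' := forward_derive_fst _ _ _ _ HG).
assert (G1 := forward_derive_fst _ _ _ _ H12').
assert (G2 := forward_derive_snd _ _ _ _ H12').
assert (G3 := forward_derive_snd _ _ _ _ HG).
set (u1 := fun t => fst (fst (u t))).
set (x := fun t => snd (fst (u t)) + Omega).
set (y := fun t => snd (u t)).
set (f2 := fun t => snd (fst (field D1 D2 D3 Omega alpha (u t)))).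
set (f3 := fun t => snd (field D1 D2 D3 Omega alpha (u t))).
assert (Gx : forward_derive x f2).
{ refine (forward_derive_ext _ _ _ _ _ _ _ (forward_derive_plus _ _ _ _ _ G2
    (forward_derive_const R_NormedModule Omega))); intros t;
  [reflexivity | apply plus_zero_r]. }
set (w := fun t => W D1 D2 D3 (x t) (y t)).
set (dw := fun t => (D2 - D1) * x t * f2 t + (D3 - D1) * y t * f3 t).
assert (GW : forward_derive w dw).
{ refine (forward_derive_ext _ _ _ _ _ _ _ (forward_derive_plus _ _ _ _ _
    (forward_derive_mult _ _ _ _ (forward_derive_const R_NormedModule (/ 2 * (D2 - D1)))
      (forward_derive_mult _ _ _ _ Gx Gx))
    (forward_derive_mult _ _ _ _ (forward_derive_const R_NormedModule (/ 2 * (D3 - D1)))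
      (forward_derive_mult _ _ _ _ G3 G3)))); intros t;
  unfold w, dw, W, f3, y, plus, zero; simpl; field. }
assert (Hdw : forall t, dw t <= - (2 * alpha * (D2 - D1) * u1 t ^ 2) * w t).
{ intros t; unfold dw, w, f2, f3, x, y, u1.
  generalize (W_dissipation_le D1 D2 D3 Omega alpha (u t) H12 H23 Ha).
  destruct (u t) as [[v1 v2] v3]; exact (fun E => E). }
assert (Hw0 : forall t, 0 <= w t).
{ intros t; unfold w, W.
  assert (0 <= (D2 - D1) * x t ^ 2)
    by (apply Rmult_le_pos; [lra | apply pow2_ge_0]).
  assert (0 <= (D3 - D1) * y t ^ 2)
    by (apply Rmult_le_pos; [lra | apply pow2_ge_0]).
  lra. }
assert (Hc : forall t, 0 <= 2 * alpha * (D2 - D1) * u1 t ^ 2)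
  by (intros t; apply Rmult_le_pos; [apply Rmult_le_pos; lra | apply pow2_ge_0]).
assert (Hsub : forall t, 0 <= t -> w t <= W0).
{ intros t Ht; apply Rle_trans with (w 0); [|exact HW].
  assert (A := gronwall_decay w dw 0 GW
    ltac:(intros s _; generalize (Hdw s) (Rmult_le_pos _ _ (Hc s) (Hw0 s)); lra) t Ht).
  rewrite Ropp_0, Rmult_0_l, exp_0 in A; lra. }
assert (E1 : forall t, 0 <= t ->
  u1 t ^ 2 = g ^ 2 + d + 2 * Omega * x t - x t ^ 2 - y t ^ 2).
{ intros t Ht.
  assert (P := Psi_conserved u _ HG
    (fun t _ => field_tangent D1 D2 D3 Omega alpha (u t)) t Ht).
  rewrite HPsi in P; unfold u1, x, y; rewrite Eg.
  destruct (u t) as [[v1 v2] v3]; simpl in P |- *; lra. }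
assert (B1 : forall t, 0 <= t -> (3 / 4 * g) ^ 2 <= u1 t ^ 2).
{ intros t Ht; rewrite (E1 t Ht).
  apply (energy_sublevel_bounds (D2 - D1) (D3 - D1) Omega g d (x t) (y t)); try lra.
  exact (Hsub t Ht). }
assert (Hg2 : 0 < g ^ 2) by now apply pow_lt.
assert (P1 : forall t, 0 <= t -> 0 < u1 t).
{ apply (forward_derive_pos _ _ G1 Hpos); intros t Ht E0.
  change (u1 t = 0) in E0; generalize (B1 t Ht); rewrite E0; lra. }
(* The rate alpha p g^2 is at most 2 alpha p u1^2, since 2 (3/4)^2 > 1. *)
assert (Hk : 0 < alpha * (D2 - D1) * g ^ 2)
  by (repeat apply Rmult_lt_0_compat; lra).
assert (Dec : forall t, 0 <= t ->
  w t <= w 0 * exp (- (alpha * (D2 - D1) * g ^ 2) * t)).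
{ apply (gronwall_decay w dw _ GW); intros t Ht.
  apply Rle_trans with (1 := Hdw t).
  assert (A : 0 <= alpha * (D2 - D1) * (2 * u1 t ^ 2 - g ^ 2) * w t).
  { apply Rmult_le_pos; [|apply Hw0]; apply Rmult_le_pos.
    - apply Rmult_le_pos; lra.
    - generalize (B1 t (Rlt_le _ _ Ht)); lra. }
  lra. }
assert (Lx : is_lim x p_infty 0).
{ apply (is_lim_0_of_sqr_le_exp x (2 / (D2 - D1) * w 0) _ Hk); intros t Ht.
  assert (A := Dec t Ht); unfold w at 1, W in A.
  assert (0 <= (D3 - D1) * y t ^ 2)
    by (apply Rmult_le_pos; [lra | apply pow2_ge_0]).
  apply Rmult_le_reg_l with (/ 2 * (D2 - D1)); [lra|].
  rewrite <- Rmult_assoc.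
  replace (/ 2 * (D2 - D1) * (2 / (D2 - D1) * w 0)) with (w 0) by (field; lra).
  lra. }
assert (Ly : is_lim y p_infty 0).
{ apply (is_lim_0_of_sqr_le_exp y (2 / (D3 - D1) * w 0) _ Hk); intros t Ht.
  assert (A := Dec t Ht); unfold w at 1, W in A.
  assert (0 <= (D2 - D1) * x t ^ 2)
    by (apply Rmult_le_pos; [lra | apply pow2_ge_0]).
  apply Rmult_le_reg_l with (/ 2 * (D3 - D1)); [lra|].
  rewrite <- Rmult_assoc.
  replace (/ 2 * (D3 - D1) * (2 / (D3 - D1) * w 0)) with (w 0) by (field; lra).
  lra. }
assert (L1 : is_lim u1 p_infty (sqrt (g ^ 2 + d))).
{ apply (is_lim_ext_loc
    (fun t => sqrt (g ^ 2 + d + (2 * Omega * x t - x t * x t - y t * y t)))).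
  - exists 0; intros t Ht.
    rewrite <- (sqrt_pow2 (u1 t)) by (apply Rlt_le, P1; lra).
    rewrite E1 by lra; f_equal; ring.
  - assert (A : is_lim (fun t => g ^ 2 + d + (2 * Omega * x t - x t * x t - y t * y t))
                  p_infty (g ^ 2 + d + (2 * Omega * 0 - 0 * 0 - 0 * 0))).
    { apply is_lim_plus'; [apply is_lim_const|].
      apply is_lim_minus'; [apply is_lim_minus'|].
      - refine (is_lim_mult _ x p_infty (2 * Omega) 0 _ Lx I); apply is_lim_const.
      - exact (is_lim_mult x x p_infty 0 0 Lx Lx I).
      - exact (is_lim_mult y y p_infty 0 0 Ly Ly I). }
    replace (g ^ 2 + d + (2 * Omega * 0 - 0 * 0 - 0 * 0)) with (g ^ 2 + d) in A by ring.
    exact (is_lim_comp_continuous _ sqrt _ _ A (continuous_sqrt _)). }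
apply filterlim_prod; [apply filterlim_prod|].
- exact L1.
- assert (A : is_lim (fun t => x t - Omega) p_infty (0 - Omega))
    by (apply is_lim_minus'; [exact Lx | apply is_lim_const]).
  rewrite Rminus_0_l in A.
  apply (is_lim_ext _ (fun t => snd (fst (u t)))) in A; [exact A|].
  intros t; unfold x; ring.
- exact Ly.
Qed.

(** * Translation to the variables U *)

Lemma filterlim_plus_const {T : Type} {V : NormedModule R_AbsRing}
    {G : (T -> Prop) -> Prop} {FG : Filter G} (f : T -> V) (l c : V) :
  filterlim f G (locally l) ->
  filterlim (fun t => plus (f t) c) G (locally (plus l c)).
Proof.
intros H; apply (filterlim_comp_2 f (fun _ => c) plus H (filterlim_const c)).
apply filterlim_plus.
Qed.

Lemma solution_plus_const (F G : R3 -> R3) (u : R -> R3) (c : R3) :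
  (forall v, F (plus v c) = G v) ->
  solution G u -> solution F (fun t => plus (u t) c).
Proof.
intros E [H0 Hd]; split; [exact (filterlim_plus_const u (u 0) c H0)|].
intros t Ht; rewrite E, <- (plus_zero_r (G (u t))).
apply (is_derive_plus (K := R_AbsRing) u (fun _ => c) t (G (u t)) zero (Hd t Ht)).
apply @is_derive_const.
Qed.

Lemma fieldU_global_solution (D1 D2 D3 Omega alpha : R) (U0 : R3) :
  exists U, solution (fieldU D1 D2 D3 Omega alpha) U /\ U 0 = U0.
Proof.
destruct (field_global_solution D1 D2 D3 Omega alpha (plus U0 (s_plus Omega)))
  as [u [Hu H0]].
exists (fun t => plus (u t) (opp (s_plus Omega))); split.
- apply (solution_plus_const _ (field D1 D2 D3 Omega alpha)); [|exact Hu].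
  intros v; unfold fieldU; f_equal; exact (plus_opp_cancel _ v (s_plus Omega)).
- rewrite H0; exact (minus_plus_r _ U0 (s_plus Omega)).
Qed.

Lemma field_converges_from_B (D1 D2 D3 Omega alpha d : R) (u : R -> R3) :
  D1 < D2 -> D2 < D3 -> 0 < Omega ->
  3 * Omega ^ 2 >= 2 * (D2 - D1) / (D3 - D1) ->
  16 * sqrt ((D2 - D1) / (D3 - D1)) <= gam Omega ->
  0 < alpha -> Rabs d <= (gam Omega / 4) ^ 2 ->
  solution (field D1 D2 D3 Omega alpha) u ->
  B D1 D2 D3 Omega (1 + d) (minus (u 0) (s_plus Omega)) ->
  filterlim u (Rbar_locally p_infty)
    (locally ((sqrt (gam Omega ^ 2 + d), - Omega, 0) : R3)).
Proof.
intros H12 H23 HO Hyp1 Hyp2 Ha Hd Hu HB.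
destruct (parameter_bounds _ _ _ _ H12 H23 HO Hyp1 Hyp2) as [Hg _].
assert (K : 0 < fst (fst (u 0)) /\ Psi (u 0) = 1 + d /\
  W D1 D2 D3 (snd (fst (u 0)) + Omega) (snd (u 0))
    <= ((D2 - D1) * gam Omega) ^ 2 / (32 * (D3 - D1) * Omega ^ 2)).
{ unfold B, PsiU in HB.
  change (plus (minus (u 0) (s_plus Omega)) (s_plus Omega))
    with (plus (plus (u 0) (opp (s_plus Omega))) (s_plus Omega)) in HB.
  destruct (u 0) as [[a b] c]; simpl in HB |- *.
  unfold prod_plus, prod_opp, plus, opp in HB; simpl in HB.
  destruct HB as [H1 [H2 H3]]; apply Rabs_le_between in H1.
  split; [lra|]; split.
  - rewrite <- H3; ring.
  - eapply Rle_trans; [apply Req_le|exact H2]; unfold W; ring. }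
destruct K as [K1 [K2 K3]].
exact (field_converges D1 D2 D3 Omega alpha d u H12 H23 HO Hyp1 Hyp2 Ha Hd Hu K1 K2 K3).
Qed.

Lemma fieldU_converges (D1 D2 D3 Omega alpha d : R) (U : R -> R3) :
  D1 < D2 -> D2 < D3 -> 0 < Omega ->
  3 * Omega ^ 2 >= 2 * (D2 - D1) / (D3 - D1) ->
  16 * sqrt ((D2 - D1) / (D3 - D1)) <= gam Omega ->
  0 < alpha -> Rabs d <= (gam Omega / 4) ^ 2 ->
  solution (fieldU D1 D2 D3 Omega alpha) U ->
  B D1 D2 D3 Omega (1 + d) (U 0) ->
  filterlim U (Rbar_locally p_infty) (locally (U_inf Omega d)).
Proof.
intros H12 H23 HO Hyp1 Hyp2 Ha Hd HU HB.
assert (K : forall v : R3, minus (plus v (s_plus Omega)) (s_plus Omega) = v)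
  by (intros v; exact (minus_plus_r _ v (s_plus Omega))).
assert (Hu := solution_plus_const (field D1 D2 D3 Omega alpha) _ U (s_plus Omega)
                (fun v => eq_refl) HU).
assert (L := field_converges_from_B D1 D2 D3 Omega alpha d _ H12 H23 HO Hyp1 Hyp2
               Ha Hd Hu ltac:(cbv beta; rewrite K; exact HB)).
apply (filterlim_plus_const _ _ (opp (s_plus Omega))) in L.
replace (U_inf Omega d)
  with (plus ((sqrt (gam Omega ^ 2 + d), - Omega, 0) : R3) (opp (s_plus Omega))).
- refine (filterlim_ext _ _ _ L); intros t; exact (K (U t)).
- change ((sqrt (gam Omega ^ 2 + d) + - gam Omega, - Omega + - - Omega, 0 + - 0)
          = U_inf Omega d).
  unfold U_inf; now rewrite Rplus_opp_r, Rplus_opp_r, Rplus_comm.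
Qed.

Lemma norm3_U_inf (Omega d : R) :
  norm3 (U_inf Omega d) = Rabs (sqrt (gam Omega ^ 2 + d) - gam Omega).
Proof.
unfold norm3, U_inf; rewrite <- sqrt_Rsqr_abs; f_equal; unfold Rsqr; ring.
Qed.

(** sqrt (g^2 + d) - g = d / (sqrt (g^2 + d) + g), whose denominator is at least
    twice any common lower bound of g and sqrt (g^2 + d). *)
Lemma abs_sqrt_sub_le (g d m : R) :
  0 < m -> m <= g -> m <= sqrt (g ^ 2 + d) -> 0 <= g ^ 2 + d ->
  Rabs (sqrt (g ^ 2 + d) - g) <= Rabs d / (2 * m).
Proof.
intros Hm Hg Hs Hd.
assert (E : d = (sqrt (g ^ 2 + d) - g) * (sqrt (g ^ 2 + d) + g)).
{ assert (A := pow2_sqrt (g ^ 2 + d) Hd); lra. }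
set (s := sqrt (g ^ 2 + d)) in *.
apply Rmult_le_reg_r with (2 * m); [lra|].
replace (Rabs d / (2 * m) * (2 * m)) with (Rabs d) by (field; lra).
rewrite E, Rabs_mult, (Rabs_pos_eq (s + g)) by lra.
apply Rmult_le_compat_l; [apply Rabs_pos | lra].
Qed.

(** The point above (U2, U3) is found by solving PsiU = 1 + d for U1; the bounds
    (3 gamma / 4)^2 and (5 gamma / 4)^2 on (U1 + gamma)^2 say that |U1| <= gamma / 4. *)
Lemma disk_in_projection (D1 D2 D3 Omega d U2 U3 : R) :
  D1 < D2 -> D2 < D3 -> 0 < Omega ->
  3 * Omega ^ 2 >= 2 * (D2 - D1) / (D3 - D1) ->
  16 * sqrt ((D2 - D1) / (D3 - D1)) <= gam Omega ->
  Rabs d <= (gam Omega / 4) ^ 2 ->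
  sqrt (U2 ^ 2 + U3 ^ 2) <= r_sm D1 D2 D3 Omega ->
  exists U1, B D1 D2 D3 Omega (1 + d) (U1, U2, U3).
Proof.
intros H12 H23 HO Hyp1 Hyp2 Hd Hr.
destruct (parameter_bounds _ _ _ _ H12 H23 HO Hyp1 Hyp2) as [Hg [Eg [Hq1 Hq2]]].
assert (HW : W D1 D2 D3 U2 U3
  <= ((D2 - D1) * gam Omega) ^ 2 / (32 * (D3 - D1) * Omega ^ 2)).
{ assert (H2 := pow2_ge_0 U2); assert (H3 := pow2_ge_0 U3).
  assert (A : sqrt (U2 ^ 2 + U3 ^ 2) ^ 2 <= r_sm D1 D2 D3 Omega ^ 2)
    by (apply pow_incr; split; [apply sqrt_pos | exact Hr]).
  rewrite pow2_sqrt in A by lra.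
  apply Rle_trans with (/ 2 * (D3 - D1) * r_sm D1 D2 D3 Omega ^ 2).
  - apply Rle_trans with (/ 2 * (D3 - D1) * (U2 ^ 2 + U3 ^ 2)).
    + assert (0 <= (D3 - D2) * U2 ^ 2) by (apply Rmult_le_pos; lra).
      unfold W; lra.
    + apply Rmult_le_compat_l; lra.
  - apply Req_le; unfold r_sm; rewrite Rabs_pos_eq by lra; field; lra. }
destruct (energy_sublevel_bounds (D2 - D1) (D3 - D1) Omega (gam Omega) d U2 U3)
  as [L1 L2]; try lra; [exact HW|].
set (r := gam Omega ^ 2 + d + 2 * Omega * U2 - U2 ^ 2 - U3 ^ 2) in *.
assert (Hr0 : 0 <= r) by (apply Rle_trans with (2 := L1), pow2_ge_0).
apply sqrt_le_1_alt in L1; apply sqrt_le_1_alt in L2.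
rewrite sqrt_pow2 in L1, L2 by lra.
exists (sqrt r - gam Omega); split; [|split; [exact HW|]].
- apply Rabs_le_between; lra.
- assert (S := pow2_sqrt r Hr0).
  change ((sqrt r - gam Omega + gam Omega) ^ 2 + (U2 + - Omega) ^ 2 + (U3 + 0) ^ 2 = 1 + d).
  replace (sqrt r - gam Omega + gam Omega) with (sqrt r) by ring.
  rewrite S; unfold r; lra.
Qed.

Theorem lemma7p1 : forall D1 D2 D3 Omega : R,
  0 < D1 -> D1 < D2 -> D2 < D3 -> 0 < Omega ->
  3 * Omega ^ 2 >= 2 * (D2 - D1) / (D3 - D1) ->
  16 * sqrt ((D2 - D1) / (D3 - D1)) <= gam Omega ->
  (forall alpha delta : R,
     0 < alpha -> Rabs delta <= (gam Omega / 4) ^ 2 ->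
     (forall U0 : R3, B D1 D2 D3 Omega (1 + delta) U0 ->
        exists U : R -> R3,
          solution (fieldU D1 D2 D3 Omega alpha) U /\ U 0 = U0) /\
     (forall U : R -> R3,
        solution (fieldU D1 D2 D3 Omega alpha) U ->
        B D1 D2 D3 Omega (1 + delta) (U 0) ->
        filterlim U (Rbar_locally p_infty) (locally (U_inf Omega delta))) /\
     (0 <= delta -> norm3 (U_inf Omega delta) <= delta / (2 * gam Omega)) /\
     (delta < 0 ->
        norm3 (U_inf Omega delta)
          <= Rabs delta / (2 * sqrt (gam Omega ^ 2 + delta)))) /\
  (forall alpha : R, 0 < alpha ->
     (forall U : R -> R3,
        solution (fieldU D1 D2 D3 Omega alpha) U ->
        B D1 D2 D3 Omega 1 (U 0) ->
        filterlim U (Rbar_locally p_infty) (locally ((0, 0, 0) : R3))) /\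
     (forall u : R -> R3,
        solution (field D1 D2 D3 Omega alpha) u ->
        B D1 D2 D3 Omega 1 (minus (u 0) (s_plus Omega)) ->
        filterlim u (Rbar_locally p_infty) (locally (s_plus Omega)))) /\
  (forall delta : R, Rabs delta <= (gam Omega / 4) ^ 2 ->
     forall U2 U3 : R,
       sqrt (U2 ^ 2 + U3 ^ 2) <= r_sm D1 D2 D3 Omega ->
       exists U1 : R, B D1 D2 D3 Omega (1 + delta) (U1, U2, U3)).
Proof.
intros D1 D2 D3 Omega HD1 H12 H23 HO Hyp1 Hyp2.
destruct (parameter_bounds _ _ _ _ H12 H23 HO Hyp1 Hyp2) as [Hg _].
assert (Hg2 : 0 < gam Omega ^ 2) by now apply pow_lt.
split; [|split].
- intros alpha d Ha Hd.
  assert (Hd' := proj1 (Rabs_le_between _ _) Hd).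
  assert (Hs : sqrt (gam Omega ^ 2) = gam Omega) by (apply sqrt_pow2; lra).
  split; [|split; [|split]].
  + intros U0 _; apply fieldU_global_solution.
  + intros U HU HB; now apply (fieldU_converges D1 D2 D3 Omega alpha).
  + intros Hd0; rewrite norm3_U_inf.
    apply Rle_trans with (Rabs d / (2 * gam Omega)); [|rewrite Rabs_pos_eq; lra].
    apply abs_sqrt_sub_le; try lra.
    apply Rle_trans with (sqrt (gam Omega ^ 2)); [lra | apply sqrt_le_1_alt; lra].
  + intros Hd0; rewrite norm3_U_inf.
    apply abs_sqrt_sub_le; try lra; [apply sqrt_lt_R0; lra|].
    apply Rle_trans with (sqrt (gam Omega ^ 2)); [apply sqrt_le_1_alt; lra | lra].
- intros alpha Ha.
  assert (Hd : Rabs 0 <= (gam Omega / 4) ^ 2) by (rewrite Rabs_R0; apply pow2_ge_0).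
  assert (S0 : sqrt (gam Omega ^ 2 + 0) = gam Omega)
    by (rewrite Rplus_0_r; apply sqrt_pow2; lra).
  split; [intros U HU HB | intros u Hu HB]; rewrite <- (Rplus_0_r 1) in HB.
  + replace ((0, 0, 0) : R3) with (U_inf Omega 0)
      by (unfold U_inf; rewrite S0; repeat f_equal; ring).
    now apply (fieldU_converges D1 D2 D3 Omega alpha).
  + unfold s_plus; rewrite <- S0.
    now apply (field_converges_from_B D1 D2 D3 Omega alpha).
- intros d Hd U2 U3 Hr; now apply disk_in_projection.
Qed.
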